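(* Let $p,q\ge 0$ with $p+q\ge1$, and let $\mathbb{V}=\mathbb{R}^{p+q}$ with the quadratic form $\Phi_{p,q}(x_1,\dots,x_{p+q})=x_1^2+\dots+x_p^2-(x_{p+1}^2+\dots+x_{p+q}^2)$. Let $\rho:\Gamma_{p,q}\to\mathrm{O}(p,q)$, $\rho_x(v)=\alpha(x)vx^{-1}$, be the twisted adjoint action. Then the restriction of $\rho$ to $\mathrm{Pin}(p,q)$ is a surjective group homomorphism $\rho:\mathrm{Pin}(p,q)\to\mathrm{O}(p,q)$ with $\ker(\rho)=\{-1,+1\}$. Moreover, the restriction $\rho:\mathrm{Spin}(p,q)\to\mathrm{SO}(p,q)$ is also a surjective group homomorphism, with the same kernel $\{-1,+1\}$ (in other words, $\{-1,+1\}\subset\mathrm{Spin}(p,q)$).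
   Context: $\mathrm{Cl}_{p,q}$ is the Clifford algebra of $(\mathbb{V},\Phi_{p,q})$: the universal unital associative real algebra with a linear map $i:\mathbb{V}\to\mathrm{Cl}_{p,q}$ satisfying $i(v)^2=\Phi_{p,q}(v)1$; $i$ is injective and $\mathbb{V}$ is identified with its image. $\alpha$ is the unique algebra automorphism with $\alpha(v)=-v$ for $v\in\mathbb{V}$; $t$ is the unique linear anti-automorphism with $t(v)=v$ for $v\in\mathbb{V}$; $\overline{x}=\alpha(t(x))$; $N(x)=x\overline{x}$. $\mathrm{Cl}_{p,q}^0=\{x:\alpha(x)=x\}$. $\Gamma_{p,q}=\{x\in\mathrm{Cl}_{p,q}^*:\alpha(x)vx^{-1}\in\mathbb{V}\ \forall v\in\mathbb{V}\}$, where $\mathrm{Cl}_{p,q}^*$ is the group of invertible elements. $\mathrm{Pin}(p,q)=\{x\in\Gamma_{p,q}: N(x)\in\{-1,+1\}\}$ (real scalars identified with multiples of $1$) and $\mathrm{Spin}(p,q)=\mathrm{Pin}(p,q)\cap\mathrm{Cl}^0_{p,q}$. $\mathrm{O}(p,q)$ is the group of linear automorphisms of $\mathbb{V}$ preserving $\Phi_{p,q}$, and $\mathrm{SO}(p,q)$ its subgroup of elements of determinant $+1$. *)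

(* Defs.v *)
From HB Require Import structures.
From mathcomp Require Import all_boot all_order all_algebra.
From mathcomp Require Import boolp classical_sets functions reals.

Set Implicit Arguments.
Unset Strict Implicit.
Unset Printing Implicit Defensive.

Import Order.TTheory GRing.Theory Num.Theory.
Local Open Scope classical_set_scope.
Local Open Scope ring_scope.

Definition Phi (R : realType) (p q : nat) (v : 'rV[R]_(p + q)) : R :=
  \sum_(i < p) v 0 (lshift q i) ^+ 2 - \sum_(j < q) v 0 (rshift p j) ^+ 2.

Definition signature_coef (R : realType) (p q : nat) (k : 'I_(p + q)) : R :=
  if (k < p)%N then 1 else -1.

Lemma PhiE (R : realType) (p q : nat) (v : 'rV[R]_(p + q)) :
  Phi v = \sum_k signature_coef R k * v 0 k ^+ 2.
Proof.
rewrite big_split_ord /Phi -sumrN /signature_coef /=.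
congr (_ + _); apply: eq_bigr => i _; first by rewrite ltn_ord mul1r.
by rewrite ltnNge leq_addr mulN1r.
Qed.

Lemma Phi_delta (R : realType) (p q : nat) (v : 'rV[R]_(p + q)) j :
  Phi (v + delta_mx 0 j) =
  Phi v + signature_coef R j * (v 0 j *+ 2) + signature_coef R j.
Proof.
rewrite !PhiE (bigD1 j) //= [X in _ = X + _ + _](bigD1 j) //=.
rewrite !mxE !eqxx /= (eq_bigr (fun k => signature_coef R k * v 0 k ^+ 2)).
  by rewrite sqrrD1 !mulrDr mulr1 addrAC; congr (_ + _); rewrite addrAC.
by move=> k /negPf kj; rewrite !mxE kj andbF addr0.
Qed.

(* A Clifford algebra is given by its universal property.  Its carrier is a   *)
(* unitAlgType only so that inverses can be written: the test algebras B are  *)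
(* arbitrary.                                                                 *)
Record cliffordAlgebra (R : realType) (p q : nat) := CliffordAlgebra {
  clifford_sort :> unitAlgType R;
  iota : {linear 'rV[R]_(p + q) -> clifford_sort};
  iota_sq : forall v, iota v * iota v = (Phi v)%:A;
  clifford_universal : forall (B : algType R)
    (f : {linear 'rV[R]_(p + q) -> B}),
    (forall v, f v * f v = (Phi v)%:A) ->
    exists2 F : {lrmorphism clifford_sort -> B},
      (forall v, F (iota v) = f v) &
      (forall G : {lrmorphism clifford_sort -> B},
         (forall v, G (iota v) = f v) -> G =1 F)
}.
Arguments iota {R p q} c.
Arguments clifford_universal {R p q} c {B f}.

(* The opposite of an algebra is an algebra: linear anti-endomorphisms of A   *)
(* are the algebra morphisms A -> A^c.                                        *)
Section OppositeAlgebra.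
Context (R : realType) (A : algType R).

HB.instance Definition _ := GRing.Lmodule.copy A^c A.

HB.instance Definition _ := GRing.Lmodule_isLalgebra.Build R A^c
  (fun a x y => @scalerAr _ A a y x).

HB.instance Definition _ := GRing.Lalgebra_isAlgebra.Build R A^c
  (fun a x y => @scalerAl _ A a y x).

End OppositeAlgebra.

Section CliffordGroups.
Context (R : realType) (p q : nat) (C : cliffordAlgebra R p q).
Local Notation V := 'rV[R]_(p + q).

Lemma alpha_subproof : exists F : {lrmorphism C -> C},
  forall v, F (iota C v) = - iota C v.
Proof.
have sq v : (- iota C v) * (- iota C v) = (Phi v)%:A by rewrite mulrNN iota_sq.
have [F FE _] := clifford_universal C (f := -%R \o iota C) sq.
by exists F.
Qed.

Definition alpha : {lrmorphism C -> C} := sval (cid alpha_subproof).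

Lemma alpha_iota v : alpha (iota C v) = - iota C v.
Proof. exact: (svalP (cid alpha_subproof)). Qed.

Lemma clifford_morph_ext (B : algType R) (F G : {lrmorphism C -> B}) :
  (forall v, F (iota C v) = G (iota C v)) -> F =1 G.
Proof.
move=> FG.
have sq v : (G \o iota C) v * (G \o iota C) v = (Phi v)%:A.
  by rewrite /= -rmorphM iota_sq /= linearZ /= rmorph1.
have [H _ HU] := clifford_universal C (f := G \o iota C) sq.
by move=> x; rewrite (HU F FG) (HU G).
Qed.

Lemma alpha_unique (F : {lrmorphism C -> C}) :
  (forall v, F (iota C v) = - iota C v) -> F =1 alpha.
Proof. by move=> FE; apply: clifford_morph_ext => v; rewrite FE alpha_iota. Qed.

Lemma alphaK : involutive alpha.
Proof.
apply: (clifford_morph_ext (F := alpha \o alpha) (G := idfun)) => v /=.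
by rewrite alpha_iota raddfN /= alpha_iota opprK.
Qed.

Lemma transp_subproof : exists F : {lrmorphism C -> (C : algType R)^c},
  forall v, F (iota C v) = iota C v.
Proof.
have lf : linear (iota C : V -> C^c) by move=> a u v; rewrite linearP.
pose f : {linear V -> C^c} :=
  HB.pack (iota C : V -> C^c) (GRing.isLinear.Build _ _ _ _ _ lf).
have sq v : f v * f v = (Phi v)%:A by exact: iota_sq.
have [F FE _] := clifford_universal C sq.
by exists F.
Qed.

(* The linear anti-automorphism t.                                            *)
Definition transp : C -> C := sval (cid transp_subproof).

Lemma transp_iota v : transp (iota C v) = iota C v.
Proof. exact: (svalP (cid transp_subproof)). Qed.

Lemma transp_linear : linear transp.
Proof. by move=> a x y; rewrite /transp linearP. Qed.

Lemma transp1 : transp 1 = 1.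
Proof. exact: (rmorph1 (sval (cid transp_subproof))). Qed.

Lemma transpM x y : transp (x * y) = transp y * transp x.
Proof. exact: (rmorphM (sval (cid transp_subproof))). Qed.

Lemma transp_unique (f : C -> C) : linear f -> f 1 = 1 ->
  (forall x y, f (x * y) = f y * f x) ->
  (forall v, f (iota C v) = iota C v) -> f =1 transp.
Proof.
move=> lf f1 fM fE.
have lf' : linear (f : C -> C^c) by [].
have mf : monoid_morphism (f : C -> C^c) by split=> // x y; exact: fM.
pose F : {lrmorphism C -> C^c} := HB.pack (f : C -> C^c)
  (GRing.isLinear.Build _ _ _ _ _ lf')
  (GRing.isMonoidMorphism.Build _ _ _ mf).
apply: (clifford_morph_ext (F := F) (G := sval (cid transp_subproof))) => v /=.
by rewrite fE -[RHS]/(transp _) transp_iota.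
Qed.

Lemma transpK : involutive transp.
Proof.
have lf : linear (transp \o transp) by move=> a x y /=; rewrite !transp_linear.
have mf : monoid_morphism (transp \o transp).
  by split=> [|x y] /=; rewrite ?transp1 // !transpM.
pose F : {lrmorphism C -> C} := HB.pack (transp \o transp)
  (GRing.isLinear.Build _ _ _ _ _ lf)
  (GRing.isMonoidMorphism.Build _ _ _ mf).
apply: (clifford_morph_ext (F := F) (G := idfun)) => v /=.
by rewrite !transp_iota.
Qed.

Definition cconj (x : C) : C := alpha (transp x).

Definition cnorm (x : C) : C := x * cconj x.

Definition Cl0 : set C := [set x | alpha x = x].

Definition Gamma : set C := [set x | x \is a GRing.unit /\
  forall v, exists w, iota C w = alpha x * iota C v * x^-1].

Definition Pin : set C := [set x | Gamma x /\ (cnorm x = -1 \/ cnorm x = 1)].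

Definition Spin : set C := Pin `&` Cl0.

(* As V is identified with its image under iota, rho x v is the w : V with    *)
(* iota w = alpha x * iota v * x^-1; this is meaningful for x in Gamma only.  *)
Definition rho (x : C) (v : V) : V :=
  xget 0 [set w | iota C w = alpha x * iota C v * x^-1].

Lemma rhoE x v : Gamma x -> iota C (rho x v) = alpha x * iota C v * x^-1.
Proof. by case=> _ /(_ v) vP; exact: (xgetPex 0 vP). Qed.

Lemma iota_inj : injective (iota C).
Proof.
suff ker0 (v : V) : iota C v = 0 -> v = 0.
  by move=> u v uv; apply/subr0_eq/ker0; rewrite linearB /= uv subrr.
move=> v0.
have Phi_addv u : Phi (v + u) = Phi u.
  apply: (fmorph_inj (in_alg C)); rewrite /= -!iota_sq.
  by rewrite linearD /= v0 add0r.
apply/rowP => j; rewrite [RHS]mxE.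
have := Phi_delta (0 : V) j; rewrite add0r -Phi_addv Phi_delta.
rewrite -[in LHS](addr0 v) Phi_addv addr0 mxE mul0rn mulr0 addr0.
rewrite -[RHS]addr0 [RHS]addrAC => /addIr/addrI/eqP; rewrite mulf_eq0 mulrn_eq0.
by rewrite /signature_coef /=; case: ifP => _;
  rewrite ?oppr_eq0 oner_eq0 => /eqP.
Qed.

End CliffordGroups.

Arguments Cl0 {R p q} C.
Arguments Gamma {R p q} C.
Arguments Pin {R p q} C.
Arguments Spin {R p q} C.
Arguments rho {R p q} C x v.

Definition Orth (R : realType) (p q : nat) :
    set ('rV[R]_(p + q) -> 'rV[R]_(p + q)) :=
  [set f | [/\ linear f, bijective f & forall v, Phi (f v) = Phi v]].

Definition SOrth (R : realType) (p q : nat) :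
    set ('rV[R]_(p + q) -> 'rV[R]_(p + q)) :=
  @Orth R p q `&` [set f | \det (lin1_mx f) = 1].

Arguments Orth : clear implicits.
Arguments SOrth : clear implicits.

Definition is_group (T : Type) (op : T -> T -> T) (e : T) (G : set T) : Prop :=
  [/\ G e,
      forall x y, G x -> G y -> G (op x y),
      forall x y z, G x -> G y -> G z -> op x (op y z) = op (op x y) z,
      forall x, G x -> op e x = x /\ op x e = x
    & forall x, G x -> exists2 y, G y & op x y = e /\ op y x = e].

Definition is_group_hom (T U : Type) (opT : T -> T -> T) (eT : T) (G : set T)
    (opU : U -> U -> U) (eU : U) (H : set U) (f : T -> U) : Prop :=
  [/\ is_group opT eT G, is_group opU eU H, set_fun G H f
    & forall x y, G x -> G y -> f (opT x y) = opU (f x) (f y)].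

Definition group_ker (T U : Type) (G : set T) (eU : U) (f : T -> U) : set T :=
  [set x | G x /\ f x = eU].

(* Existence: Cl_{p,q} has a basis (e_S) indexed by the subsets S of 'I_(p+q),*)
(* with e_S * e_T = reorder_sign S T *: e_(S symdiff T).                      *)
Section CliffordModel.
Context (R : realType) (p q : nat).
Local Notation I := 'I_(p + q).
Local Notation V := 'rV[R]_(p + q).
Local Notation sg := (@signature_coef R p q).

Definition symdiff (S T : {set I}) : {set I} :=
  [set i | (i \in S) (+) (i \in T)]%SET.

Lemma symdiffA : associative symdiff.
Proof. by move=> A B D; apply/setP => i; rewrite !inE addbA. Qed.
Lemma symdiffC : commutative symdiff.
Proof. by move=> A B; apply/setP => i; rewrite !inE addbC. Qed.
Lemma symdiff0 A : symdiff finset.set0 A = A.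
Proof. by apply/setP => i; rewrite !inE. Qed.
Lemma symdiffKK A : involutive (symdiff A).
Proof. by move=> B; apply/setP => i; rewrite !inE addKb. Qed.

Lemma prod_enum_set1 (A : nzRingType) (i : I) (F : I -> A) :
  \prod_(k <- enum I | k \in [set i]%SET) F k = F i.
Proof.
rewrite (eq_bigl (pred1 i)) => [|k]; last by rewrite !inE.
by rewrite -big_filter filter_pred1_uniq ?enum_uniq ?mem_enum // big_seq1.
Qed.

Definition swap_sign (i j : I) : R :=
  if i == j then sg i else if (j < i)%N then -1 else 1.

Lemma swap_signM i j : swap_sign i j * swap_sign i j = 1.
Proof.
by rewrite /swap_sign /signature_coef; do !case: ifP => _;
  rewrite ?mulrNN mulr1.
Qed.

Definition reorder_sign_on (r : seq I) (S T : {set I}) : R :=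
  \prod_(i <- r | i \in S) \prod_(j <- r | j \in T) swap_sign i j.
Definition reorder_sign := reorder_sign_on (enum I).

Lemma big_symdiff (r : seq I) (F : I -> R) S T :
  (forall i, F i * F i = 1) ->
  \prod_(i <- r | i \in symdiff S T) F i =
  \prod_(i <- r | i \in S) F i * \prod_(i <- r | i \in T) F i.
Proof.
move=> FF; rewrite !(big_mkcond (fun i => i \in _)) -big_split /=.
apply: eq_bigr => i _; rewrite inE.
by case: (i \in S) (i \in T) => [] [] /=; rewrite ?FF ?mulr1 ?mul1r.
Qed.

Lemma prodr_sq1 (r : seq I) (P : pred I) (F : I -> R) :
  (forall i, F i * F i = 1) ->
  (\prod_(i <- r | P i) F i) * (\prod_(i <- r | P i) F i) = 1.
Proof. by move=> FF; rewrite -big_split big1 /=. Qed.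

Lemma reorder_signDl S S' T :
  reorder_sign (symdiff S S') T = reorder_sign S T * reorder_sign S' T.
Proof.
rewrite /reorder_sign /reorder_sign_on big_symdiff // => i.
by apply: prodr_sq1 => j; exact: swap_signM.
Qed.

Lemma reorder_signDr S T T' :
  reorder_sign S (symdiff T T') = reorder_sign S T * reorder_sign S T'.
Proof.
rewrite /reorder_sign /reorder_sign_on -big_split; apply: eq_bigr => i _ /=.
by rewrite big_symdiff // => j; exact: swap_signM.
Qed.

Lemma reorder_sign0l T : reorder_sign finset.set0 T = 1.
Proof. by rewrite /reorder_sign /reorder_sign_on big1 // => i; rewrite inE. Qed.
Lemma reorder_sign0r S : reorder_sign S finset.set0 = 1.
Proof.
by rewrite /reorder_sign /reorder_sign_on big1 // => i _; rewrite big1 // => j;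
  rewrite inE.
Qed.

Definition clifford_rel (A : algType R) (e : I -> A) : Prop :=
  (forall i, e i * e i = (sg i)%:A) /\
  (forall i j, i != j -> e i * e j = - (e j * e i)).

Lemma clifford_rel_of (A : algType R) (f : {linear V -> A}) :
  (forall v, f v * f v = (Phi v)%:A) ->
  clifford_rel (fun i => f (delta_mx 0 i)).
Proof.
move=> fsq.
have Phi0 : Phi (0 : V) = 0.
  by rewrite PhiE big1 // => k _; rewrite mxE expr0n mulr0.
have Phid i : Phi (delta_mx 0 i : V) = sg i.
  by rewrite -[X in Phi X]add0r Phi_delta mxE mul0rn mulr0 Phi0 !add0r.
split=> [i|i j nij]; first by rewrite fsq Phid.
have := fsq (delta_mx 0 i + delta_mx 0 j).
rewrite Phi_delta mxE eqxx /= eq_sym (negPf nij) mul0rn mulr0 addr0 Phid.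
rewrite linearD mulrDl !mulrDr !fsq !Phid scalerDl addrA => /addIr.
by rewrite -[RHS]addr0 -addrA => /addrI /eqP; rewrite addr_eq0 => /eqP.
Qed.

Lemma clifford_rel_sq (A : algType R) (e : I -> A) (v : V) :
  clifford_rel e ->
  (\sum_k v 0 k *: e k) * (\sum_k v 0 k *: e k) = (Phi v)%:A.
Proof.
case=> esq eanti; rewrite mulr_suml PhiE scaler_suml.
have EQ k : v 0 k *: e k * (\sum_l v 0 l *: e l) =
   (sg k * v 0 k ^+ 2)%:A +
   \sum_(l | l != k) (v 0 k * v 0 l) *: (e k * e l).
  rewrite mulr_sumr (bigD1 k) //=; congr (_ + _).
    by rewrite -scalerAl -scalerAr esq !scalerA mulrC expr2.
  by apply: eq_bigr => l _; rewrite -scalerAl -scalerAr scalerA.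
rewrite (eq_bigr _ (fun k _ => EQ k)) big_split /= -[RHS]addr0; congr (_ + _).
set X := \sum_k _.
have XN : X = - X.
  rewrite /X -sumrN (exchange_big_dep xpredT) //=.
  apply: eq_bigr => k _; rewrite -sumrN.
  apply: eq_big => l; first by rewrite eq_sym.
  by move=> kl; rewrite mulrC (eanti k l kl) scalerN opprK.
have : 2%:R *: X = 0 by rewrite scaler_nat mulr2n {1}XN addNr.
by move/eqP; rewrite scaler_eq0 pnatr_eq0 => /eqP.
Qed.

Definition mono (A : algType R) (e : I -> A) (r : seq I) (S : {set I}) : A :=
  \prod_(i <- r | i \in S) e i.

Lemma mono_comm (A : algType R) (e : I -> A) (r : seq I) (i : I) S :
  clifford_rel e -> all (fun j : I => (i < j)%N) r ->
  mono e r S * e i =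
  (\prod_(j <- r | j \in S) swap_sign j i) *: (e i * mono e r S).
Proof.
move=> erel; rewrite /mono; elim: r => [|j r IHr] /=.
  by rewrite !big_nil mul1r mulr1 scale1r.
case/andP => ij ir; rewrite !big_cons; case: ifP => _; last exact: IHr.
have nji : j != i by apply: contraTneq ij => ->; rewrite ltnn.
rewrite -mulrA IHr // -scalerAr (mulrA (e j)) (erel.2 _ _ nji) mulNr -mulrA.
rewrite scalerN -scaleNr.
by rewrite /swap_sign (negPf nji) ij mulN1r.
Qed.

Lemma monoM (A : algType R) (e : I -> A) (r : seq I) S T :
  clifford_rel e -> sorted (fun i j : I => (i < j)%N) r ->
  mono e r S * mono e r T = reorder_sign_on r S T *: mono e r (symdiff S T).
Proof.
move=> erel; rewrite /mono /reorder_sign_on; elim: r => [|i r IHr].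
  by rewrite !big_nil mulr1 scale1r.
rewrite /= path_sortedE; last by move=> ? ? ?; exact: ltn_trans.
case/andP => ir /IHr{}IHr.
have comm := mono_comm S erel ir; rewrite /mono in comm.
have one_i : \prod_(j <- r | j \in T) swap_sign i j = 1.
  rewrite big_seq_cond big1 // => j /andP[jr _]; move/allP: ir => /(_ j jr) ij.
  by rewrite /swap_sign ifN ?ltnNge ?(ltnW ij) //; apply: contraTneq ij => ->;
    rewrite ltnn.
have inner :
  \prod_(k <- r | k \in S) \prod_(j <- i :: r | j \in T) swap_sign k j
  = (if i \in T then \prod_(k <- r | k \in S) swap_sign k i else 1) *
    \prod_(k <- r | k \in S) \prod_(j <- r | j \in T) swap_sign k j.
  under eq_bigr do rewrite big_cons.
  by case: (i \in T); rewrite ?mul1r // big_split.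
rewrite !big_cons inE one_i inner mulr1.
case: (i \in S) (i \in T) => [] [] /=; rewrite ?mul1r.
- rewrite mulrA -(mulrA (e i)) comm -scalerAr -scalerAl (mulrA (e i) (e i)).
  rewrite erel.1 -mulrA IHr.
  rewrite -scalerAl mul1r !scalerA /swap_sign eqxx.
  by congr (_ *: _); rewrite [in RHS]mulrA [sg i * _]mulrC.
- by rewrite -mulrA IHr scalerAr.
- by rewrite mulrA comm -scalerAl -mulrA IHr -scalerAr scalerA.
- exact: IHr.
Qed.

Lemma enum_ord_sorted : sorted (fun i j : I => (i < j)%N) (enum I).
Proof.
have : sorted ltn (map val (enum I)) by rewrite val_enum_ord iota_ltn_sorted.
by rewrite sorted_map.
Qed.

Definition clifford_model := {ffun {set I} -> R^o}.

HB.instance Definition _ := GRing.Lmodule.copy clifford_model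
  {ffun {set I} -> R^o}.

Definition cm_mul (x y : clifford_model) : clifford_model :=
  [ffun U => \sum_S reorder_sign S (symdiff S U) * x S * y (symdiff S U)].
Definition cm_basis (S : {set I}) : clifford_model := [ffun U => (U == S)%:R].

Lemma symdiff_inj S : injective (symdiff S).
Proof. exact: inv_inj (symdiffKK S). Qed.

Lemma symdiff_eq S T U : (symdiff S T == U) = (T == symdiff S U).
Proof. by rewrite -(inj_eq (@symdiff_inj S)) symdiffKK. Qed.

Lemma cm_mulA : associative cm_mul.
Proof.
move=> x y z; apply/ffunP => U; rewrite !ffunE.
under eq_bigr do rewrite ffunE mulr_sumr.
under [RHS]eq_bigr do rewrite ffunE mulr_sumr mulr_suml.
rewrite [RHS]exchange_big /=; apply: eq_bigr => S _.
rewrite [RHS](reindex_inj (@symdiff_inj S)) /=; apply: eq_bigr => T _.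
have WE : symdiff T (symdiff S U) = symdiff S (symdiff T U).
  by rewrite !symdiffA (symdiffC T).
rewrite (symdiffKK S T) -symdiffA WE; set W := symdiff S (symdiff T U).
have -> : symdiff S U = symdiff T W by rewrite /W -WE symdiffKK.
rewrite reorder_signDr reorder_signDl !mulrA; congr (_ * _); congr (_ * _).
by rewrite mulrAC; congr (_ * _); rewrite [RHS]mulrC mulrA.
Qed.

Lemma cm_mulDl : left_distributive cm_mul +%R.
Proof.
move=> x y z; apply/ffunP => U; rewrite !ffunE -big_split /=.
by apply: eq_bigr => S _; rewrite ffunE mulrDr mulrDl.
Qed.

Lemma cm_mulDr : right_distributive cm_mul +%R.
Proof.
move=> x y z; apply/ffunP => U; rewrite !ffunE -big_split /=.
by apply: eq_bigr => S _; rewrite ffunE mulrDr.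
Qed.

Lemma cm_basisM S T :
  cm_mul (cm_basis S) (cm_basis T) = reorder_sign S T *: cm_basis (symdiff S T).
Proof.
apply/ffunP => U; rewrite !ffunE (bigD1 S) //= !ffunE eqxx mulr1.
rewrite big1 ?addr0 => [|S' /negPf nS]; last by rewrite !ffunE nS mulr0 mul0r.
rewrite symdiff_eq; case: eqP => [->|_]; last by rewrite !mulr0 scaler0.
by rewrite symdiffKK.
Qed.

Lemma cm_mul1l : left_id (cm_basis finset.set0) cm_mul.
Proof.
move=> x; apply/ffunP => U; rewrite !ffunE (bigD1 finset.set0) //= !ffunE eqxx.
rewrite big1 ?addr0 => [|S' /negPf nS]; last by rewrite !ffunE nS mulr0 mul0r.
by rewrite reorder_sign0l !mul1r symdiff0.
Qed.

Lemma cm_mul1r : right_id (cm_basis finset.set0) cm_mul.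
Proof.
move=> x; apply/ffunP => U; rewrite !ffunE (bigD1 U) //= !ffunE.
have UU : symdiff U U = finset.set0 by apply/setP => i; rewrite !inE addbb.
rewrite big1 ?addr0 => [|S' nS].
  by rewrite UU eqxx reorder_sign0r mul1r mulr1.
rewrite !ffunE symdiff_eq.
have -> : symdiff S' finset.set0 = S' by rewrite symdiffC symdiff0.
by rewrite eq_sym (negPf nS) mulr0.
Qed.

Lemma cm_basis0_neq0 : cm_basis finset.set0 != 0.
Proof.
apply/eqP => /ffunP /(_ finset.set0); rewrite !ffunE eqxx => /eqP.
by rewrite oner_eq0.
Qed.

HB.instance Definition _ := GRing.Zmodule_isNzRing.Build clifford_model
  cm_mulA cm_mul1l cm_mul1r cm_mulDl cm_mulDr cm_basis0_neq0.

Fact cm_scalerAl (a : R) (x y : clifford_model) : a *: (x * y) = (a *: x) * y.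
Proof.
apply/ffunP => U; rewrite !ffunE scaler_sumr.
apply: eq_bigr => S _; rewrite !ffunE -[a *: x S]/(a * x S) -[LHS]/(a * _).
by rewrite !mulrA (mulrC a).
Qed.

HB.instance Definition _ :=
  GRing.Lmodule_isLalgebra.Build R clifford_model cm_scalerAl.

Fact cm_scalerAr (a : R) (x y : clifford_model) : a *: (x * y) = x * (a *: y).
Proof.
apply/ffunP => U; rewrite !ffunE scaler_sumr.
apply: eq_bigr => S _; rewrite ffunE -[LHS]/(a * _).
by rewrite -[a *: y _]/(a * y _) mulrCA.
Qed.

HB.instance Definition _ :=
  GRing.Lalgebra_isAlgebra.Build R clifford_model cm_scalerAr.

Definition cm_unit (x : clifford_model) : bool :=
  `[< exists y, y * x = 1 /\ x * y = 1 >].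
Definition cm_inv (x : clifford_model) : clifford_model :=
  if pselect (exists y, y * x = 1 /\ x * y = 1) is left e then sval (cid e)
  else x.

Fact cm_mulVr : {in cm_unit, left_inverse 1 cm_inv *%R}.
Proof.
move=> x /asboolP ex; rewrite /cm_inv; case: pselect => // e.
by case: (svalP (cid e)).
Qed.
Fact cm_divrr : {in cm_unit, right_inverse 1 cm_inv *%R}.
Proof.
move=> x /asboolP ex; rewrite /cm_inv; case: pselect => // e.
by case: (svalP (cid e)).
Qed.
Fact cm_unitrP (x y : clifford_model) : y * x = 1 /\ x * y = 1 -> cm_unit x.
Proof. by move=> xy; apply/asboolP; exists y. Qed.
Fact cm_invr_out : {in [predC cm_unit], cm_inv =1 id}.
Proof.
move=> x; rewrite inE /cm_inv => /negP nx; case: pselect => // e.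
by case: nx; apply/asboolP.
Qed.

HB.instance Definition _ := GRing.NzRing_hasMulInverse.Build clifford_model
  cm_mulVr cm_divrr cm_unitrP cm_invr_out.

Definition cm_e (i : I) : clifford_model := cm_basis [set i]%SET.

Lemma cm_basisE S T :
  cm_basis S * cm_basis T = reorder_sign S T *: cm_basis (symdiff S T).
Proof. exact: cm_basisM. Qed.

Lemma reorder_sign1 i j : reorder_sign [set i]%SET [set j]%SET = swap_sign i j.
Proof.
by rewrite /reorder_sign /reorder_sign_on !prod_enum_set1.
Qed.

Lemma cm_e_rel : clifford_rel cm_e.
Proof.
split=> [i|i j nij]; rewrite /cm_e !cm_basisE !reorder_sign1.
  rewrite /swap_sign eqxx; congr (_ *: cm_basis _).
  by apply/setP => k; rewrite !inE addbb.
rewrite symdiffC -scaleNr; congr (_ *: _).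
rewrite /swap_sign (negPf nij) eq_sym (negPf nij).
case: (ltngtP i j) => [||/val_inj/eqP]; rewrite ?opprK ?(negPf nij) //.
Qed.

Lemma cm_basis_mono S : cm_basis S = mono cm_e (enum I) S.
Proof.
have -> : S = [set i in enum I | i \in S]%SET.
  by apply/setP => i; rewrite !inE mem_enum.
rewrite [RHS](eq_bigl (fun i => i \in S)) => [|i];
  last by rewrite !inE mem_enum.
elim: (enum I) enum_ord_sorted => [_|i r IHr].
  by rewrite big_nil; congr cm_basis; apply/setP => i; rewrite !inE.
rewrite /= path_sortedE; last by move=> ? ? ?; exact: ltn_trans.
case/andP => ir /IHr{}IHr; rewrite big_cons -IHr.
case: ifP => iS; last first.
  congr cm_basis; apply/setP => j; rewrite !inE.
  by case: eqP => // ->; rewrite iS !andbF.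
have inr : i \notin r by apply/negP => /(allP ir); rewrite ltnn.
rewrite /cm_e cm_basisE -[LHS]scale1r; congr (_ *: cm_basis _).
  rewrite /reorder_sign /reorder_sign_on big_enum_cond /= big_set1 big1 // => j.
  rewrite inE => /andP[/(allP ir) ij _]; rewrite /swap_sign ifN.
    by rewrite ltnNge (ltnW ij).
  by apply: contraTneq ij => ->; rewrite ltnn.
apply/setP => j; rewrite !inE.
by case: eqP => [->|_] //=; rewrite iS (negPf inr).
Qed.

Definition cm_iota (v : V) : clifford_model := \sum_k v 0 k *: cm_e k.

Fact cm_iota_linear : linear cm_iota.
Proof.
move=> a u v; rewrite /cm_iota scaler_sumr -big_split /=.
by apply: eq_bigr => k _; rewrite !mxE scalerDl scalerA.
Qed.

HB.instance Definition _ :=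
  GRing.isLinear.Build R V clifford_model _ cm_iota cm_iota_linear.

Lemma cm_iota_delta i : cm_iota (delta_mx 0 i) = cm_e i.
Proof.
rewrite /cm_iota (bigD1 i) //= mxE !eqxx scale1r big1 ?addr0 // => k /negPf ki.
by rewrite mxE ki andbF scale0r.
Qed.

Lemma cm_sum (x : clifford_model) : x = \sum_S x S *: cm_basis S.
Proof.
apply/ffunP => U; rewrite sum_ffunE (bigD1 U) //= !ffunE eqxx big1.
  by rewrite addr0 -[RHS]/(_ * _) mulr1.
by move=> S nS; rewrite !ffunE eq_sym (negPf nS) scaler0.
Qed.

Lemma cm_universal (B : algType R) (f : {linear V -> B}) :
  (forall v, f v * f v = (Phi v)%:A) ->
  exists2 F : {lrmorphism clifford_model -> B},
    (forall v, F (cm_iota v) = f v) &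
    (forall G : {lrmorphism clifford_model -> B},
       (forall v, G (cm_iota v) = f v) -> G =1 F).
Proof.
move=> /clifford_rel_of; set e := fun i => _ => erel.
pose F (x : clifford_model) : B := \sum_S x S *: mono e (enum I) S.
have Fl : linear F.
  move=> a x y; rewrite /F scaler_sumr -big_split; apply: eq_bigr => S _ /=.
  by rewrite !ffunE scalerDl scalerA.
pose Fl' : {linear clifford_model -> B} :=
  HB.pack F (GRing.isLinear.Build _ _ _ _ _ Fl).
have FB S : F (cm_basis S) = mono e (enum I) S.
  rewrite /F (bigD1 S) //= ffunE eqxx scale1r big1 ?addr0 // => T /negPf nT.
  by rewrite ffunE nT scale0r.
have Fm : monoid_morphism F.
  split=> [|x y].
    by rewrite FB /mono big1 // => i; rewrite inE.
  rewrite {1}(cm_sum x) {1}(cm_sum y) mulr_suml.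
  rewrite -[F]/(Fl' : _ -> _) linear_sum [in RHS](cm_sum x) linear_sum.
  rewrite mulr_suml.
  apply: eq_bigr => S _; rewrite mulr_sumr [in RHS](cm_sum y) !linear_sum.
  rewrite mulr_sumr.
  apply: eq_bigr => T _; rewrite -scalerAl -scalerAr cm_basisE !linearZ /=.
  by rewrite !FB -scalerAl -scalerAr monoM // enum_ord_sorted.
pose F' : {lrmorphism clifford_model -> B} := HB.pack F
  (GRing.isLinear.Build _ _ _ _ _ Fl) (GRing.isMonoidMorphism.Build _ _ _ Fm).
have Fe i : F (cm_e i) = e i.
  by rewrite FB /mono prod_enum_set1.
exists F' => [v|G GE x].
  rewrite -[F' _]/(Fl' _) /cm_iota linear_sum.
  rewrite [v in RHS]row_sum_delta linear_sum.
  by apply: eq_bigr => k _; rewrite !linearZ /= Fe.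
rewrite (cm_sum x) !linear_sum; apply: eq_bigr => S _; rewrite !linearZ /= FB.
congr (_ *: _); rewrite cm_basis_mono /mono rmorph_prod; apply: eq_bigr => i _.
by rewrite -cm_iota_delta; exact: GE.
Qed.

Definition canonicalClifford : cliffordAlgebra R p q := CliffordAlgebra
  (iota := cm_iota) (fun v => clifford_rel_sq v cm_e_rel) cm_universal.

End CliffordModel.

(* Main.v *)
From HB Require Import structures.
Require Import Defs.
From mathcomp Require Import all_boot all_order all_algebra.
From mathcomp Require Import boolp classical_sets functions reals.
From mathcomp Require Import ring lra.

Set Implicit Arguments.
Unset Strict Implicit.
Unset Printing Implicit Defensive.

Import GRing.Theory Num.Theory.
Local Open Scope classical_set_scope.
Local Open Scope ring_scope.

(* A vector [u] with [Phi u <> 0] is invertible in the Clifford algebra and its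
   twisted adjoint action is the reflection in [u], so surjectivity reduces to
   writing an isometry as a product of reflections in vectors with
   [Phi u = 1] or [-1]. If [rho x] is the identity then [alpha x * v = v * x] for
   all [v], which forces [x] to be a scalar, and [N x = 1] or [-1] leaves only [1]
   and [-1]. Hence every [x] in Pin is up to sign a product of [k] vectors; then
   [alpha x = (-1)^k x = det (rho x) x], so that [x] is even exactly when
   [rho x] has determinant 1. *)

(** Sylvester's identity, which will reduce the determinant of a reflection to size 1. An upper and
    a lower unitriangular factor each make the block matrix with rows [(1, A)] and [(B, 1)]
    triangular. *)
Lemma det_1_sub_mulmx (K : comNzRingType) m n (A : 'M[K]_(m, n))
    (B : 'M[K]_(n, m)) : \det (1%:M - A *m B) = \det (1%:M - B *m A).
Proof.
have := congr1 determinant (mulmx_block 1%:M (- A) 0 1%:M 1%:M A B 1%:M).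
rewrite det_mulmx det_ublock !det1 !mul1r !mul1mx !mul0mx !mulmx1.
rewrite !mulNmx !add0r subrr det_lblock det1 mulr1 => <-.
have := congr1 determinant (mulmx_block 1%:M 0 (- B) 1%:M 1%:M A B 1%:M).
rewrite det_mulmx det_lblock !det1 !mul1r !mul1mx !mul0mx !mulmx1.
by rewrite !mulNmx !addr0 addNr det_ublock det1 mul1r addrC => ->.
Qed.

(** * Linear endomorphisms and their determinants *)

Section LinearMaps.
Context (R : fieldType) (n : nat).
Implicit Types f g : 'rV[R]_n -> 'rV[R]_n.

Lemma lin1_mxE f : linear f -> f =1 mulmxr (lin1_mx f).
Proof.
move=> lf; pose F : {linear 'rV[R]_n -> 'rV[R]_n} :=
  HB.pack f (GRing.isLinear.Build _ _ _ _ _ lf).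
by move=> v; rewrite /= (mul_rV_lin1 F).
Qed.

Lemma eq_lin1_mx f (A : 'M[R]_n) : f =1 mulmxr A -> lin1_mx f = A.
Proof.
move=> fA; apply/matrixP => i j.
by rewrite mxE fA /= -rowE mxE.
Qed.

Lemma linear_comp f g : linear f -> linear g -> linear (f \o g).
Proof. by move=> lf lg a u v; rewrite /= lg lf. Qed.

Lemma det_lin1_comp f g : linear f -> linear g ->
  \det (lin1_mx (f \o g)) = \det (lin1_mx f) * \det (lin1_mx g).
Proof.
move=> lf lg; rewrite mulrC -det_mulmx; congr determinant.
by apply: eq_lin1_mx => v; rewrite /= mulmxA (lin1_mxE lf) (lin1_mxE lg).
Qed.

Lemma det_lin1_id : \det (lin1_mx (idfun : 'rV[R]_n -> 'rV[R]_n)) = 1.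
Proof.
rewrite (@eq_lin1_mx _ 1%:M) ?det1 // => v.
by rewrite /= mulmx1.
Qed.

Lemma linear_inj_bij f : linear f -> injective f -> bijective f.
Proof.
move=> lf injf; have fE := lin1_mxE lf.
have f0 : f 0 = 0 by rewrite fE /= mul0mx.
have uf : lin1_mx f \in unitmx.
  rewrite -row_free_unit; apply: inj_row_free => v.
  by have /= <- := fE v => fv0; apply: injf; rewrite f0.
exists (mulmxr (invmx (lin1_mx f))) => v; rewrite /= fE /=.
  by rewrite mulmxK.
by rewrite mulmxKV.
Qed.

Lemma linear_cancel f g : linear f -> cancel f g -> cancel g f -> linear g.
Proof.
by move=> lf fK gK a u v; apply: (can_inj fK); rewrite lf !gK.
Qed.

End LinearMaps.

(** * Polar form, isometries and reflections *)

Section Reflections.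
Context (R : realType) (p q : nat).
Local Notation V := 'rV[R]_(p + q).
Local Notation sg := (@signature_coef R p q).
Implicit Types (u v w : V) (f g : V -> V).

Definition polar u v : R := \sum_k sg k * u 0 k * v 0 k.

Lemma polarC u v : polar u v = polar v u.
Proof. by apply: eq_bigr => k _; rewrite mulrAC. Qed.

Lemma polarDr u v w : polar u (v + w) = polar u v + polar u w.
Proof. by rewrite -big_split; apply: eq_bigr => k _; rewrite mxE mulrDr. Qed.

Lemma polarZr a u v : polar u (a *: v) = a * polar u v.
Proof. by rewrite mulr_sumr; apply: eq_bigr => k _; rewrite mxE mulrCA. Qed.

Lemma polarNr u v : polar u (- v) = - polar u v.
Proof. by rewrite -scaleN1r polarZr mulN1r. Qed.

Lemma polarDl u v w : polar (u + v) w = polar u w + polar v w.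
Proof. by rewrite polarC polarDr !(polarC w). Qed.

Lemma polarNl u v : polar (- u) v = - polar u v.
Proof. by rewrite polarC polarNr polarC. Qed.

Lemma polar_diag v : polar v v = Phi v.
Proof. by rewrite PhiE; apply: eq_bigr => k _; rewrite -mulrA expr2. Qed.

Lemma PhiD u v : Phi (u + v) = Phi u + Phi v + 2 * polar u v.
Proof.
by rewrite -!polar_diag polarDr !polarDl (polarC v u); ring.
Qed.

Lemma PhiN v : Phi (- v) = Phi v.
Proof. by rewrite -!polar_diag polarNr polarNl opprK. Qed.

Lemma PhiZ a v : Phi (a *: v) = a ^+ 2 * Phi v.
Proof.
by rewrite -!polar_diag polarZr polarC polarZr mulrA expr2.
Qed.

Lemma polar_delta i j :
  polar (delta_mx 0 i) (delta_mx 0 j) = if i == j then sg i else 0.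
Proof.
rewrite /polar (bigD1 i) //= big1 ?addr0 => [|k /negPf ki].
  by rewrite !mxE !eqxx mulr1 /=; case: eqP; rewrite ?mulr1 ?mulr0.
by rewrite !mxE ki andbF mulr0 mul0r.
Qed.

Lemma signature_coef_sq i : sg i * sg i = 1.
Proof. by rewrite /signature_coef; case: ifP; rewrite ?mulrNN mulr1. Qed.

Lemma signature_coef_neq0 i : sg i != 0.
Proof. by rewrite /signature_coef; case: ifP; rewrite ?oppr_eq0 oner_eq0. Qed.

Lemma Orth_polar f u v : Orth R p q f -> polar (f u) (f v) = polar u v.
Proof.
case=> lf _ fP; have := fP (u + v).
have -> : f (u + v) = f u + f v.
  by have := lf 1 u v; rewrite !scale1r.
by rewrite !PhiD !fP; lra.
Qed.

Lemma Orth_id : Orth R p q idfun.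
Proof. by split=> //; exists idfun. Qed.

Lemma Orth_comp f g : Orth R p q f -> Orth R p q g -> Orth R p q (f \o g).
Proof.
case=> lf bf fP [lg bg gP]; split; first exact: linear_comp.
  exact: bij_comp.
by move=> v; rewrite /= fP gP.
Qed.

Lemma Orth_inv f : Orth R p q f ->
  exists2 g, Orth R p q g & f \o g = idfun /\ g \o f = idfun.
Proof.
case=> lf [g fK gK] fP; exists g.
  split; first exact: linear_cancel fK gK.
    by exists f.
  by move=> v; rewrite -fP gK.
by split; apply/funext => v /=.
Qed.

(* For [Phi u = 0], division by zero makes this the identity. *)
Definition reflection u v : V := v - (2 * polar u v / Phi u) *: u.

Lemma reflection_linear u : linear (reflection u).
Proof.
move=> a v w; rewrite /reflection polarDr polarZr.
by apply/rowP => k; rewrite !mxE; ring.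
Qed.

Lemma polar_reflection u v : Phi u != 0 ->
  polar u (reflection u v) = - polar u v.
Proof.
by move=> u0; rewrite /reflection polarDr polarNr polarZr polar_diag; field.
Qed.

Lemma reflectionK u : Phi u != 0 -> involutive (reflection u).
Proof.
move=> u0 v; rewrite {1}/reflection polar_reflection //.
by apply/rowP => k; rewrite !mxE; ring.
Qed.

Lemma reflection_Orth u : Phi u != 0 -> Orth R p q (reflection u).
Proof.
move=> u0; split; first exact: reflection_linear.
  by exists (reflection u); exact: reflectionK.
move=> v; rewrite /reflection PhiD PhiN PhiZ polarNr polarZr (polarC v).
by field.
Qed.

Lemma reflection_fix u v : polar u v = 0 -> reflection u v = v.
Proof. by rewrite /reflection => ->; rewrite mulr0 mul0r scale0r subr0. Qed.

(** Equal values of [Phi] give [Phi (v - w) = - 2 * polar (v - w) w], so the coefficient in the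
    reflection is [-1]. *)
Lemma reflection_swap v w : Phi v = Phi w -> Phi (v - w) != 0 ->
  reflection (v - w) w = v.
Proof.
move=> vw uw0; rewrite /reflection.
suff -> : 2 * polar (v - w) w / Phi (v - w) = - 1.
  by rewrite scaleN1r opprK addrC subrK.
rewrite (_ : 2 * _ = - Phi (v - w)); first by rewrite mulNr divff.
by rewrite PhiD PhiN polarNr polarDl polarNl polar_diag vw; ring.
Qed.

(** The matrix is a rank-one perturbation [1 - c u] of the identity, with [u c = 2]; Sylvester's
    identity leaves [1 - 2]. *)
Lemma det_reflection u : Phi u != 0 -> \det (lin1_mx (reflection u)) = - 1.
Proof.
move=> u0; pose c : 'cV[R]_(p + q) := \col_k (2 * sg k * u 0 k / Phi u).
rewrite (@eq_lin1_mx _ _ _ (1%:M - c *m u)); last first.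
  move=> v; rewrite /= mulmxBr mulmx1 mulmxA.
  congr (_ - _); apply/rowP => k; rewrite !mxE big_ord1 !mxE; congr (_ * _).
  rewrite mulr_sumr mulr_suml; apply: eq_bigr => i _.
  by rewrite !mxE; ring.
rewrite det_1_sub_mulmx det_mx11 !mxE /=.
rewrite (_ : \sum_j _ = 2); first by ring.
transitivity (2 * polar u u / Phi u); last by rewrite polar_diag; field.
rewrite mulr_sumr mulr_suml; apply: eq_bigr => i _.
by rewrite !mxE; ring.
Qed.

(** A reflection depends only on the line spanned by its vector, so [u] may be divided by the square
    root of [|Phi u|]. *)
Lemma reflection_normalize u : Phi u != 0 ->
  exists2 w, Phi w = 1 \/ Phi w = -1 & reflection w = reflection u.
Proof.
move=> u0; pose a := Num.sqrt `|Phi u|.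
have a2 : a ^+ 2 = `|Phi u| by rewrite sqr_sqrtr.
have a0 : a != 0 by rewrite -sqrf_eq0 a2 normr_eq0.
have Pw : Phi (a^-1 *: u) = `|Phi u|^-1 * Phi u by rewrite PhiZ exprVn a2.
exists (a^-1 *: u).
  rewrite Pw; case: (ltrP 0 (Phi u)) => [pu|nu].
    by left; rewrite gtr0_norm ?mulVf.
  by right; rewrite ler0_norm // invrN mulNr mulVf.
apply/funext => v; rewrite /reflection scalerA polarC polarZr (polarC v) PhiZ.
by congr (_ - _ *: _); field; rewrite a0 u0.
Qed.

Let e i : V := delta_mx 0 i.

(* Cartan-Dieudonne without a bound on the number of reflections: if [f] fixes
   [e_j] for [j < i], then one or two reflections in vectors orthogonal to these
   [e_j] send [f e_i] back to [e_i]. *)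
Lemma Orth_reflection_ind (P : (V -> V) -> Prop) :
  P idfun ->
  (forall u f, Phi u != 0 -> Orth R p q f -> P f -> P (reflection u \o f)) ->
  forall f, Orth R p q f -> P f.
Proof.
move=> P1 PS.
(* Reflections are involutions, so composing with one may also be undone: it suffices to move [f]
   towards the identity. *)
have Pcancel u f : Phi u != 0 -> Orth R p q f ->
    P (reflection u \o f) -> P f.
  move=> u0 Of /(PS u _ u0 (Orth_comp (reflection_Orth u0) Of)).
  by congr P; apply/funext => v /=; rewrite reflectionK.
(* [k] bounds the number of basis vectors not yet known to be fixed; at [k = p + q] nothing is
   assumed. *)
suff H k f : Orth R p q f ->
    (forall j : 'I_(p + q), (j < p + q - k)%N -> f (e j) = e j) -> P f.
  by move=> f Of; apply: (H (p + q)%N f Of) => j; rewrite subnn ltn0.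
elim: k f => [|k IHk] f Of fe.
  suff -> : f = idfun by [].
  case: Of => lf _ _; apply/funext => v /=.
  rewrite (lin1_mxE lf) /= -[RHS]mulmx1; congr (v *m _).
  apply/row_matrixP => j.
  by rewrite rowE row1 -[LHS]/(mulmxr _ _) -(lin1_mxE lf) fe ?subn0.
case: (leqP (p + q) k) => [nk|kn].
  by apply: IHk => // j; move: nk; rewrite -subn_eq0 => /eqP ->.
have ilt : (p + q - k.+1 < p + q)%N by rewrite ltn_subrL /=; case: (p + q)%N kn.
pose i := Ordinal ilt.
have Phie : Phi (f (e i)) = Phi (e i) by case: Of.
have step g : Orth R p q g -> g (e i) = e i ->
    (forall j : 'I_(p + q), (j < i)%N -> g (e j) = e j) -> P g.
  move=> Og gi gj; apply: IHk => // j.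
  have -> : (p + q - k = i.+1)%N.
    by rewrite /= subnS prednK // subn_gt0.
  by rewrite ltnS leq_eqVlt => /orP[/eqP/val_inj->|/gj].
have ort (j : 'I_(p + q)) : (j < i)%N ->
    polar (e i) (e j) = 0 /\ polar (f (e i)) (e j) = 0.
  move=> ji; have ij : polar (e i) (e j) = 0.
    by rewrite polar_delta; case: eqP ji => // ->; rewrite ltnn.
  by split=> //; rewrite -(fe j ji) Orth_polar.
have [d0|d0] := eqVneq (Phi (e i - f (e i))) 0; last first.
  apply: (Pcancel _ _ d0 Of); apply: step.
  - exact: Orth_comp (reflection_Orth d0) Of.
  - by rewrite /= reflection_swap.
  - move=> j ji; rewrite /= (fe j ji) reflection_fix //.
    by have [ij fij] := ort j ji; rewrite polarDl polarNl ij fij subrr.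
have ei0 : Phi (e i) != 0.
  by rewrite -polar_diag polar_delta eqxx signature_coef_neq0.
(* By the parallelogram law, [Phi (e i - f (e i)) = 0] forces [Phi (e i + f (e i)) = 4 * Phi (e i)].
   So [f (e i)] can be reflected to [- e i], and then to [e i] by the reflection in [e i]. *)
have s0 : Phi (- e i - f (e i)) != 0.
  apply: contra_neq ei0; move: d0.
  by rewrite !PhiD !PhiN !polarNr !polarNl Phie; lra.
have Of' := Orth_comp (reflection_Orth s0) Of.
apply: (Pcancel _ _ s0 Of); apply: (Pcancel _ _ ei0 Of'); apply: step.
- exact: Orth_comp (reflection_Orth ei0) Of'.
- rewrite /= reflection_swap ?PhiN //.
  rewrite /reflection polarNr polar_diag.
  by apply/rowP => k'; rewrite !mxE; field.
- move=> j ji; have [ij fij] := ort j ji.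
  rewrite /= (fe j ji) (reflection_fix (u := - _ - _)) ?reflection_fix //.
  by rewrite polarDl !polarNl ij fij oppr0 addr0.
Qed.

End Reflections.

(** * Spanning monomials and the twisted centralizer *)

Section CliffordGroups.
Context (R : realType) (p q : nat) (C : cliffordAlgebra R p q).
Local Notation V := 'rV[R]_(p + q).
Local Notation I := 'I_(p + q).
Local Notation sg := (@signature_coef R p q).
Local Notation iota := (@Defs.iota R p q).
Implicit Types (u v w : V) (x y : C).

Let e (i : I) : C := iota C (delta_mx 0 i).

(** Universality gives morphisms [G] to the model and [F] back. Their composite [F \o G] fixes all
    vectors, hence is the identity, and [F] carries the basis expansion of [G x] to one of [x]. *)
Lemma clifford_spanning x :
  exists a : {set I} -> R, x = \sum_S a S *: mono e (enum I) S.
Proof.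
have [F FE _] := @cm_universal R p q C (iota C) (@iota_sq _ _ _ C).
have [G GE _] := clifford_universal C (f := @cm_iota R p q)
  (fun v => clifford_rel_sq v (@cm_e_rel R p q)).
have FG : F (G x) = x.
  apply: (clifford_morph_ext (F := F \o G) (G := idfun)) => v /=.
  by rewrite GE FE.
exists (G x); rewrite -[LHS]FG {1}(cm_sum (G x)) linear_sum.
apply: eq_bigr => S _; rewrite linearZ /= cm_basis_mono; congr (_ *: _).
rewrite rmorph_prod; apply: eq_bigr => i _.
by rewrite -cm_iota_delta; exact: FE.
Qed.

Lemma alphaZ (a : R) x : alpha C (a *: x) = a *: alpha C x.
Proof. by rewrite linearZ. Qed.

(** For a factor [e j] with [j != i], the sign from [alpha] cancels the sign from anticommutation;
    only [j = i] leaves [-1]. *)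
Lemma alpha_mono_comm (r : seq I) (S : {set I}) i :
  alpha C (mono e r S) * e i =
  (\prod_(j <- r | j \in S) (if j == i then -1 else 1)) *:
    (e i * mono e r S).
Proof.
have [_ eN] : clifford_rel e by apply: clifford_rel_of; exact: iota_sq.
rewrite /mono; elim: r => [|j r IHr].
  by rewrite !big_nil rmorph1 mul1r mulr1 scale1r.
rewrite !big_cons; case: ifP => // _.
rewrite rmorphM /= -mulrA IHr alpha_iota -scalerAr -!scalerA mulNr.
case: eqP => [->|/eqP ji].
  by rewrite scaleN1r scalerN.
by rewrite scale1r !mulrA -mulNr -eN // eq_sym.
Qed.

(* [x |-> e_i * alpha x * e_i / e_i^2] fixes the twisted centralizer of V and
   changes the sign of the monomials containing [e_i], so no such monomial
   occurs in [x]. *)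
Lemma twisted_centralizer x :
  (forall v, alpha C x * iota C v = iota C v * x) -> exists a : R, x = a%:A.
Proof.
move=> xcomm.
have [e2 _] : clifford_rel e by apply: clifford_rel_of; exact: iota_sq.
(* Indices are eliminated one at a time; after all of [enum I], only the empty monomial [1]
   survives. *)
suff H (r : seq I) : exists a : {set I} -> R,
    x = \sum_(S : {set I} | [forall i in S, i \notin r])
          a S *: mono e (enum I) S.
  have [a ->] := H (enum I); exists (a finset.set0).
  rewrite (bigD1 finset.set0) /=; last by apply/forall_inP => i; rewrite inE.
  rewrite big1 ?addr0 => [|S /andP[/forall_inP SP]]; last first.
    by case/set0Pn => i /SP; rewrite mem_enum.
  by congr (_ *: _); rewrite /mono big1 // => i; rewrite inE.
elim: r => [|i r [a xE]].
  have [a xE] := clifford_spanning x; exists a; rewrite {1}xE.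
  by apply: eq_bigl => S; apply/esym/forall_inP.
exists a.
(* The factor [sg i] is its own inverse, so it divides by [e i * e i]. *)
pose T := fun y : C => sg i *: (e i * (alpha C y * e i)).
have Tx : T x = x.
  rewrite /T xcomm mulrA e2 -scalerAl mul1r scalerA.
  by rewrite signature_coef_sq scale1r.
have Tm S : T (mono e (enum I) S) =
    (if i \in S then -1 else 1) *: mono e (enum I) S.
  rewrite /T alpha_mono_comm -scalerAr mulrA e2 -scalerAl mul1r.
  rewrite scalerA mulrC scalerA -mulrA.
  rewrite signature_coef_sq mulr1; congr (_ *: _).
  rewrite big_enum_cond /=; case: ifPn => iS.
    by rewrite (bigD1 i) //= eqxx big1 ?mulr1 // => j /andP[_ /negPf ->].
  rewrite big1 // => j jS; rewrite ifN //.
  by apply: contraNneq iS => <-.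
have TS : T x = \sum_(S : {set I} | [forall i in S, i \notin r])
    a S *: T (mono e (enum I) S).
  have TD : {morph T : y z / y + z}.
    by move=> y z; rewrite /T rmorphD mulrDl mulrDr scalerDr.
  have T0 : T 0 = 0 by rewrite /T rmorph0 mul0r mulr0 scaler0.
  rewrite {1}xE (big_morph T TD T0); apply: eq_bigr => S _.
  by rewrite /T alphaZ -scalerAl -scalerAr !scalerA mulrC.
(* In [T x + x], monomials containing [e i] cancel and the others double. *)
have : 2%:R *: x = 2%:R *: \sum_(S : {set I} | [forall j in S, j \notin i :: r])
    a S *: mono e (enum I) S.
  rewrite !scaler_nat !mulr2n -{1}Tx TS {1}xE -!big_split /=.
  rewrite (bigID (fun S : {set I} => i \in S)) /= big1 ?add0r.
    apply: eq_big => [S|S /andP[_ /negPf iS]]; last by rewrite Tm iS scale1r.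
    apply/andP/forall_inP => [[/forall_inP Sr iS] j jS|Sr].
      rewrite inE negb_or Sr // andbT.
      by apply: contraNneq iS => <-.
    split; first by apply/forall_inP => j /Sr; rewrite inE negb_or => /andP[].
    by apply/negP => /Sr; rewrite inE eqxx.
  by move=> S /andP[_ iS]; rewrite Tm iS scaleN1r scalerN addNr.
by apply: scalerI; rewrite pnatr_eq0.
Qed.

(** * Anticommutators and conjugation *)

Lemma iota_anticomm u v :
  iota C u * iota C v + iota C v * iota C u = (2 * polar u v)%:A.
Proof.
have := iota_sq C (u + v); rewrite PhiD linearD mulrDl !mulrDr !iota_sq.
by rewrite !scalerDl [iota C v * _ + _]addrC addrACA => /addrI.
Qed.

Lemma cconjM x y : cconj (x * y) = cconj y * cconj x.
Proof. by rewrite /cconj transpM rmorphM. Qed.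

Lemma cconjZ (a : R) x : cconj (a *: x) = a *: cconj x.
Proof.
have t0 : transp (0 : C) = 0.
  by have := transp_linear (-1) (0 : C) 0; rewrite scaler0 addr0 scaleN1r addNr.
by rewrite /cconj -[a *: x]addr0 transp_linear t0 addr0 linearZ.
Qed.

Lemma cconj1 : cconj (1 : C) = 1.
Proof. by rewrite /cconj transp1 rmorph1. Qed.

Lemma cconj_iota v : cconj (iota C v) = - iota C v.
Proof. by rewrite /cconj transp_iota alpha_iota. Qed.

(** * The twisted adjoint action by isometries *)

Lemma rho_unique x f : (forall v, iota C (f v) = alpha C x * iota C v * x^-1) ->
  rho C x = f.
Proof.
move=> fE; apply/funext => v; apply: xget_unique; first exact: fE.
by move=> w wE; apply: (@iota_inj _ _ _ C); rewrite fE wE.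
Qed.

Lemma rho_linear x : Gamma C x -> linear (rho C x).
Proof.
move=> Gx a u v; apply: (@iota_inj _ _ _ C).
by rewrite linearP !(rhoE _ Gx) linearP mulrDr mulrDl -scalerAr -scalerAl.
Qed.

Lemma rho_inj x : Gamma C x -> injective (rho C x).
Proof.
move=> Gx u v /(congr1 (iota C)); have ux : x \is a GRing.unit by case: Gx.
rewrite !(rhoE _ Gx) => /(mulIr (_ : x^-1 \is a GRing.unit)).
rewrite unitrV => /(_ ux) /(mulrI (rmorph_unit (alpha C) ux)).
exact: iota_inj.
Qed.

(* Applying alpha to [alpha x * v * x^-1] in V gives [rho x v] the second
   expression [x * v * (alpha x)^-1], and the product of the two is [v * v]. *)
Lemma rho_Orth x : Gamma C x -> Orth R p q (rho C x).
Proof.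
move=> Gx; have ux : x \is a GRing.unit by case: Gx.
split; first exact: rho_linear.
  exact: linear_inj_bij (rho_linear Gx) (rho_inj Gx).
move=> v; apply: (fmorph_inj (in_alg C)); rewrite /= -!iota_sq.
have alt : iota C (rho C x v) = x * iota C v * (alpha C x)^-1.
  apply: oppr_inj; rewrite -alpha_iota (rhoE _ Gx) !rmorphM /= rmorphV //.
  by rewrite alphaK alpha_iota mulrN mulNr.
rewrite {1}(rhoE _ Gx) alt !mulrA mulrVK // -(mulrA (alpha C x)) iota_sq.
by rewrite -scalerAr mulr1 -scalerAl mulrV ?rmorph_unit.
Qed.

(** * The groups [Gamma] and [Pin] *)

Lemma Gamma1 : Gamma C 1.
Proof.
split=> [|v]; first exact: unitr1.
by exists v; rewrite rmorph1 mul1r invr1 mulr1.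
Qed.

Lemma GammaM x y : Gamma C x -> Gamma C y ->
  Gamma C (x * y) /\ rho C (x * y) = rho C x \o rho C y.
Proof.
move=> Gx Gy; have [[ux _] [uy _]] := (Gx, Gy).
have E v : iota C (rho C x (rho C y v)) =
    alpha C (x * y) * iota C v * (x * y)^-1.
  by rewrite (rhoE _ Gx) (rhoE _ Gy) rmorphM invrM // !mulrA.
split; last exact: rho_unique.
by split=> [|v]; [rewrite unitrMl | exists (rho C x (rho C y v))].
Qed.

(** In finite dimension the injective map [rho C x] is onto, and its inverse is the action of
    [x^-1]. *)
Lemma GammaV x : Gamma C x -> Gamma C x^-1.
Proof.
move=> Gx; have ux : x \is a GRing.unit by case: Gx.
split=> [|v]; first by rewrite unitrV.
have [g _ gK] := linear_inj_bij (rho_linear Gx) (rho_inj Gx).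
exists (g v); rewrite -[in RHS](gK v) (rhoE _ Gx) rmorphV // invrK !mulrA.
by rewrite mulVr ?rmorph_unit // mul1r mulrVK.
Qed.

(** In [x * cnorm y * cconj x] the middle factor is a sign, hence central, and what remains is
    [cnorm x] up to that sign. *)
Lemma PinM x y : Pin C x -> Pin C y -> Pin C (x * y).
Proof.
move=> [Gx Nx] [Gy Ny]; split; first by case: (GammaM Gx Gy).
have -> : cnorm (x * y) = x * cnorm y * cconj x.
  by rewrite /cnorm cconjM !mulrA.
case: Ny => ->; rewrite ?mulrN1 ?mulr1 ?mulNr -/(cnorm x) //.
by case: Nx => ->; rewrite ?opprK; [right|left].
Qed.

(** [cconj x = x^-1 * cnorm x] with [cnorm x] a central sign, so [cnorm x^-1] is the inverse of that
    sign, which is the sign itself. *)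
Lemma PinV x : Pin C x -> Pin C x^-1.
Proof.
move=> [Gx Nx]; have ux : x \is a GRing.unit by case: Gx.
split; first exact: GammaV.
suff Nx1 : cnorm x * cnorm x^-1 = 1.
  by case: Nx Nx1 => ->; rewrite ?mulN1r ?mul1r; [move=> /eqP|];
   [rewrite eqr_oppLR => /eqP|]; [left|right].
have cxV : cconj x^-1 * cconj x = 1 by rewrite -cconjM mulrV // cconj1.
have xN : cconj x = x^-1 * cnorm x by rewrite mulKr.
have comm : cnorm x * x^-1 = x^-1 * cnorm x.
  by case: Nx => ->; rewrite ?mulN1r ?mulrN1 ?mul1r ?mulr1.
have uN : cnorm x \is a GRing.unit by case: Nx => ->; rewrite ?unitrN1 ?unitr1.
have uc : cconj x \is a GRing.unit by rewrite xN unitrMl // unitrV.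
rewrite [cnorm x^-1]/cnorm; have -> : cconj x^-1 = (cconj x)^-1.
  by rewrite -[LHS](mulrK uc) cxV mul1r.
by rewrite mulrA comm -xN mulrV.
Qed.

Lemma Pin1 : Pin C 1.
Proof.
by split; [exact: Gamma1 | right; rewrite /cnorm cconj1 mulr1].
Qed.

Lemma PinN x : Pin C x -> Pin C (- x).
Proof.
move=> Px; rewrite -mulN1r; apply: PinM => //.
split.
  split=> [|v]; first by rewrite unitrN1.
  by exists v; rewrite rmorphN1 mulN1r invrN1 mulrN1 opprK.
by right; rewrite /cnorm -scaleN1r cconjZ cconj1 scaleN1r mulrNN mulr1.
Qed.

(** * Vectors in [Pin], lifts of isometries, kernel and parity *)

Lemma iota_unit u : Phi u != 0 -> iota C u \is a GRing.unit.
Proof.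
move=> u0; apply/unitrP; exists ((Phi u)^-1 *: iota C u).
by rewrite -scalerAl -scalerAr iota_sq scalerA mulVf // scale1r.
Qed.

(** Since [u v + v u = 2 * polar u v] and [u^-1 = u / Phi u], the product [- u v u^-1] is
    [v - (2 * polar u v / Phi u) u]; the minus sign comes from [alpha]. *)
Lemma rho_iota u : Phi u != 0 ->
  Gamma C (iota C u) /\ rho C (iota C u) = reflection u.
Proof.
move=> u0; have uu := iota_unit u0.
have E v : iota C (reflection u v) =
    alpha C (iota C u) * iota C v * (iota C u)^-1.
  apply: (mulIr uu); rewrite mulrVK // alpha_iota /reflection.
  rewrite linearB linearZ /= mulrBl -scalerAl iota_sq scalerA divfK //.
  by rewrite -iota_anticomm opprD addrCA subrr addr0 mulNr.
split; last exact: rho_unique.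
by split=> // v; exists (reflection u v).
Qed.

Lemma iota_Pin u : Phi u = 1 \/ Phi u = -1 -> Pin C (iota C u).
Proof.
move=> u1; have u0 : Phi u != 0.
  by case: u1 => ->; rewrite ?oppr_eq0 oner_eq0.
split; first by case: (rho_iota u0).
rewrite /cnorm cconj_iota mulrN iota_sq.
(* The norm of a vector is [- Phi u], so the two signs trade places. *)
by case: u1 => ->; [left | right]; rewrite ?scaleN1r ?scale1r ?opprK.
Qed.

(** The clause on [alpha] travels through the induction: each new vector factor contributes [-1] to
    both [alpha] and the determinant. *)
Lemma Pin_lift f : Orth R p q f ->
  exists x, [/\ Pin C x, rho C x = f & alpha C x = \det (lin1_mx f) *: x].
Proof.
move: f; apply: Orth_reflection_ind => [|u f u0 Of [x [Px rx ax]]].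
  exists 1; rewrite det_lin1_id scale1r rmorph1; split=> //; first exact: Pin1.
  by apply: rho_unique => v; rewrite rmorph1 mul1r invr1 mulr1.
have [w w1 <-] := reflection_normalize u0.
have w0 : Phi w != 0 by case: w1 => ->; rewrite ?oppr_eq0 oner_eq0.
have [Gw rw] := rho_iota w0.
exists (iota C w * x); split.
- by apply: PinM => //; exact: iota_Pin.
- by have [_ ->] := GammaM Gw Px.1; rewrite rw rx.
have [lf _ _] := Of.
rewrite rmorphM /= alpha_iota ax.
rewrite (det_lin1_comp (@reflection_linear _ _ _ w) lf).
by rewrite det_reflection // mulN1r scaleNr mulNr -scalerAr.
Qed.

Lemma rho_ker x : Pin C x -> rho C x = idfun -> x = -1 \/ x = 1.
Proof.
move=> [Gx Nx] rx; have ux : x \is a GRing.unit by case: Gx.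
have [a xE] : exists a : R, x = a%:A.
  apply: twisted_centralizer => v.
  have rv : rho C x v = v by rewrite rx.
  by rewrite -{2}rv (rhoE _ Gx) mulrVK.
(* Conjugation fixes scalars, so the norm of [x] is a real square; this excludes [-1] and leaves
   [a = 1] or [a = -1]. *)
have Na : cnorm x = (a * a)%:A.
  by rewrite /cnorm xE cconjZ cconj1 -scalerAl mul1r scalerA.
have : (a * a == 1) || (a * a == -1).
  case: Nx; rewrite Na => aa; apply/orP; [right | left]; apply/eqP;
  by apply: (fmorph_inj (in_alg C)); rewrite rmorphE ?rmorphN1 ?rmorph1.
rewrite -expr2 sqrf_eq1 => /orP[/orP[]/eqP a1|/eqP a1].
- by right; rewrite xE a1 scale1r.
- by left; rewrite xE a1 scaleN1r.
- by have := sqr_ge0 a; rewrite a1 oppr_ge0 ler10.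
Qed.

(** A lift [y] of [rho C x] satisfies the formula, and [y^-1 * x] lies in the kernel, so [x] is [y]
    or [- y]; the formula is insensitive to this sign. *)
Lemma alpha_Pin x : Pin C x -> alpha C x = \det (lin1_mx (rho C x)) *: x.
Proof.
move=> Px; have [y [Py ry ay]] := Pin_lift (rho_Orth Px.1).
have uy : y \is a GRing.unit by case: Py => [[]].
have Pz := PinM (PinV Py) Px.
have [_ yz] := GammaM Py.1 Pz.1.
have /(rho_ker Pz) : rho C (y^-1 * x) = idfun.
  apply/funext => v; apply: (rho_inj Py.1).
  by rewrite -[LHS]/((_ \o _) v) -yz mulVKr // ry.
move: ay; set d := \det _ => ay.
case=> /(congr1 ( *%R y)); rewrite mulVKr // ?mulrN1 ?mulr1 => ->; last by [].
by rewrite rmorphN /= ay scalerN.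
Qed.

Lemma SpinE x : Spin C x <-> Pin C x /\ \det (lin1_mx (rho C x)) = 1.
Proof.
split=> [[Px]|[Px d1]]; last first.
  by split=> //; rewrite /Cl0 /= alpha_Pin // d1 scale1r.
rewrite /Cl0 /= alpha_Pin //; set d := \det _ => /eqP.
(* Evenness gives [(d - 1) *: x = 0], and the unit [x] is nonzero. *)
rewrite -subr_eq0 -[X in _ - X](scale1r x) -scalerBl.
rewrite scaler_eq0 subr_eq0 => /orP[/eqP //|/eqP x0].
by case: Px => [[]]; rewrite x0 unitr0.
Qed.

End CliffordGroups.

Theorem mainTheorem2 (R : realType) (p q : nat) (hpq : (1 <= p + q)%N)
    (C : cliffordAlgebra R p q) :
  [/\ is_group_hom *%R 1 (Pin C)
        (fun f g : 'rV[R]_(p + q) -> 'rV[R]_(p + q) => f \o g) idfun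
        (Orth R p q) (rho C),
      set_surj (Pin C) (Orth R p q) (rho C)
    & group_ker (Pin C) idfun (rho C) = [set -1; 1]]
  /\
  [/\ is_group_hom *%R 1 (Spin C)
        (fun f g : 'rV[R]_(p + q) -> 'rV[R]_(p + q) => f \o g) idfun
        (SOrth R p q) (rho C),
      set_surj (Spin C) (SOrth R p q) (rho C)
    & group_ker (Spin C) idfun (rho C) = [set -1; 1]].
Proof.
pose V := 'rV[R]_(p + q).
have rhoM x y : Pin C x -> Pin C y -> rho C (x * y) = rho C x \o rho C y.
  by move=> [Gx _] [Gy _]; case: (GammaM Gx Gy).
have [Pin_1 Pin_N1] := (Pin1 C, PinN (Pin1 C)).
have rho1 : rho C 1 = idfun.
  by apply: rho_unique => v; rewrite rmorph1 mul1r invr1 mulr1.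
have rhoN1 : rho C (-1) = idfun.
  by apply: rho_unique => v; rewrite rmorphN1 mulN1r invrN1 mulrN1 opprK.
have unitPin x : Pin C x -> x \is a GRing.unit by case=> [[]].
(* Both [1] and [-1] act as the identity, of determinant 1, and so are even. *)
have Spin_1 : Spin C 1 by apply/SpinE; rewrite rho1 det_lin1_id.
have Spin_N1 : Spin C (-1) by apply/SpinE; rewrite rhoN1 det_lin1_id.
have detM (f g : V -> V) : Orth R p q f -> Orth R p q g ->
    \det (lin1_mx (f \o g)) = \det (lin1_mx f) * \det (lin1_mx g).
  by case=> lf _ _ [lg _ _]; exact: det_lin1_comp.
have PinG : is_group *%R 1 (Pin C).
  split=> // [x y|x y z _ _ _|x _|x Px]; first exact: PinM.
  - by rewrite mulrA.
  - by rewrite mul1r mulr1.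
  - by exists x^-1; [exact: PinV | rewrite mulrV ?mulVr ?unitPin].
have SpinG : is_group *%R 1 (Spin C).
  split=> // [x y [Px ax] [Py ay]|x y z _ _ _|x _|x [Px ax]].
  - by split; [exact: PinM | rewrite /Cl0 /= rmorphM /= ax ay].
  - by rewrite mulrA.
  - by rewrite mul1r mulr1.
  exists x^-1; last by rewrite mulrV ?mulVr ?unitPin.
  by split; [exact: PinV | rewrite /Cl0 /= rmorphV ?unitPin //= ax].
have OrthG : is_group (fun f g : V -> V => f \o g) idfun (Orth R p q).
  split=> //; [exact: Orth_comp | exact: Orth_inv].
have SOrthG : is_group (fun f g : V -> V => f \o g) idfun (SOrth R p q).
  split=> // [|f g [Of df] [Og dg]|f [Of df]].
  - by split; [exact: Orth_id | exact: det_lin1_id].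
  - by split; [exact: Orth_comp | rewrite /= detM // df dg mulr1].
  have [g Og [fg gf]] := Orth_inv Of; exists g => //; split=> //=.
  by rewrite -[LHS]mul1r -df -detM // fg det_lin1_id.
split; split.
- by split=> // x [Gx _]; exact: (rho_Orth Gx).
- by move=> f Of; have [x [Px rx _]] := Pin_lift C Of; exists x.
- apply/seteqP; split=> [x [Px rx]|x [->|->] //].
  exact: rho_ker.
- split=> // [x /SpinE[[Gx _] d1]|x y [Px _] [Py _]].
    by split=> //; exact: (rho_Orth Gx).
  exact: rhoM.
- move=> f [Of df]; have [x [Px rx _]] := Pin_lift C Of; exists x => //.
  by apply/SpinE; rewrite rx.
- apply/seteqP; split=> [x [[Px _] rx]|x [->|->] //].
  exact: rho_ker.
Qed.
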